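(* Let $A\in\mathbb{R}^{n\times n}$, $b,x_0\in\mathbb{R}^n$, $r_0=b-Ax_0$, and let $\ell$ be the maximal dimension of the Krylov subspaces $\mathcal{K}_k(A,r_0)$, $k\ge0$. Suppose $\mathrm{range}(A)=\mathrm{range}(A^\top)$ and $b\notin\mathrm{range}(A)$. Let $x_{\ell-1}$ be the $(\ell-1)$th GMRES iterate, i.e. $$x_{\ell-1}=\operatorname*{argmin}_{x\in x_0+\mathcal{K}_{\ell-1}(A,r_0)}\|b-Ax\|,$$ let $r_{\ell-1}=b-Ax_{\ell-1}$, and define the lifted vector $$\widetilde{x}_{\ell-1}=x_{\ell-1}-\frac{r_{\ell-1}^\top(x_{\ell-1}-x_0)}{r_{\ell-1}^\top r_{\ell-1}}\,r_{\ell-1}.$$ Then $\widetilde{x}_{\ell-1}$ is the orthogonal projection of $x_0$ onto the least squares solution set $\{x\in\mathbb{R}^n : A^\top Ax=A^\top b\}$; more precisely, $$\widetilde{x}_{\ell-1}=A^\dagger b+(I-A^\dagger A)x_0 .$$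
   Context: For a matrix $A\in\mathbb{R}^{n\times n}$ and a vector $v\in\mathbb{R}^n$, the $k$th Krylov subspace is $\mathcal{K}_k(A,v)=\mathrm{span}\{v,Av,\ldots,A^{k-1}v\}$, with $\mathcal{K}_0(A,v)=\{0\}$. The integer $\ell$ is characterized by $\dim\mathcal{K}_k(A,r_0)=k$ for $k\le\ell$ and $\dim\mathcal{K}_k(A,r_0)=\ell$ for $k\ge\ell+1$. $A^\dagger$ denotes the Moore--Penrose inverse of $A$, $I$ the identity matrix, and $\|\cdot\|$ the Euclidean norm. *)

(* Defs.v *)
From mathcomp Require Import all_boot all_order all_algebra.
From mathcomp Require Import classical_sets reals.

Set Implicit Arguments.
Unset Strict Implicit.
Unset Printing Implicit Defensive.

Import Order.TTheory GRing.Theory Num.Theory.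

Local Open Scope ring_scope.

(* Vectors of R^n are columns. *)

Definition dot (R : realType) (n : nat) (u v : 'cV[R]_n) : R :=
  (u^T *m v) 0 0.

(* The norm that the library puts on matrices is the sup norm, so the
   Euclidean one is defined here. *)
Definition enorm (R : realType) (n : nat) (u : 'cV[R]_n) : R :=
  Num.sqrt (\sum_(i < n) u i 0 ^+ 2).

(* MathComp's matrix subspaces are row spaces; this is the column space
   {A x | x in R^n}. *)
Definition mxrange (R : realType) (n : nat) (A : 'M[R]_n) :
    {vspace 'cV[R]_n} :=
  limg (linfun (mulmx A : 'cV[R]_n -> 'cV[R]_n)).

Lemma mxrangeP (R : realType) (n : nat) (A : 'M[R]_n) (y : 'cV[R]_n) :
  reflect (exists x, y = A *m x) (y \in mxrange A).
Proof.
apply: (iffP memv_imgP) => [[x _ ->]|[x ->]]; exists x => //.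
- by rewrite lfunE.
- by rewrite memvf.
- by rewrite lfunE.
Qed.

Definition krylov (R : realType) (n : nat) (A : 'M[R]_n) (v : 'cV[R]_n)
    (k : nat) : {vspace 'cV[R]_n} :=
  <<[seq A ^+ i *m v | i <- iota 0 k]>>%VS.

Definition max_krylov_dim (R : realType) (n : nat) (A : 'M[R]_n)
    (v : 'cV[R]_n) (l : nat) : Prop :=
  (exists k, \dim (krylov A v k) = l) /\
  (forall k, (\dim (krylov A v k) <= l)%N).

Definition gmres_iterate (R : realType) (n : nat) (A : 'M[R]_n)
    (b x0 : 'cV[R]_n) (k : nat) (x : 'cV[R]_n) : Prop :=
  let feasible (y : 'cV[R]_n) := y - x0 \in krylov A (b - A *m x0) k in
  feasible x /\
  (forall y, feasible y -> enorm (b - A *m x) <= enorm (b - A *m y)).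

Definition lsq_solutions (R : realType) (n : nat) (A : 'M[R]_n)
    (b : 'cV[R]_n) : set 'cV[R]_n :=
  [set x | A^T *m A *m x = A^T *m b]%classic.

(* p is the orthogonal projection of x onto the affine subspace S. *)
Definition orthogonal_projection (R : realType) (n : nat)
    (S : set 'cV[R]_n) (x p : 'cV[R]_n) : Prop :=
  S p /\ (forall z, S z -> dot (x - p) (z - p) = 0).

Definition penrose (R : realType) (m n : nat) (A : 'M[R]_(m, n))
    (X : 'M[R]_(n, m)) : Prop :=
  [/\ A *m X *m A = A, X *m A *m X = X,
      (A *m X)^T = A *m X & (X *m A)^T = X *m A].

(* Not to be confused with the library's pinvmx, which only satisfies
   A *m pinvmx A *m A = A. The default value 0 is never used, by mpinvP. *)
Definition mpinv (R : realType) (m n : nat) (A : 'M[R]_(m, n)) :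
    'M[R]_(n, m) :=
  xget 0 [set X | penrose A X]%classic.

Lemma gram_unit (R : realType) (m r : nat) (M : 'M[R]_(r, m)) :
  row_free M -> M *m M^T \in unitmx.
Proof.
move=> fM; rewrite -row_free_unit -kermx_eq0; apply/rowV0P => v /sub_kermxP vK.
have vM0 : v *m M = 0.
  have e : (v *m M) *m (v *m M)^T = 0.
    by rewrite trmx_mul !mulmxA -(mulmxA v) vK mul0mx.
  apply/rowP => j; rewrite [RHS]mxE.
  have /eqP := congr1 (fun B : 'M_1 => B 0 0) e; rewrite /= [X in X == _]mxE.
  rewrite [X in _ == X]mxE psumr_eq0; last first.
    by move=> i _; rewrite [(_^T) _ _]mxE -expr2 sqr_ge0.
  move=> /allP /(_ j (mem_index_enum j)) /=.
  by rewrite [(_^T) _ _]mxE -expr2 sqrf_eq0 => /eqP.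
by apply: (row_free_inj fM); rewrite vM0 mul0mx.
Qed.

Lemma penrose_exists (R : realType) (m n : nat) (A : 'M[R]_(m, n)) :
  exists X, penrose A X.
Proof.
have [r [C [B [AE fC fB]]]] : exists r (C : 'M[R]_(m, r)) (B : 'M[R]_(r, n)),
    [/\ A = C *m B, row_full C & row_free B].
  exists (\rank A), (col_base A), (row_base A).
  by rewrite mulmx_base col_base_full row_base_free.
have uB : B *m B^T \in unitmx by exact: gram_unit.
have uC : C^T *m C \in unitmx.
  rewrite -{2}(trmxK C); apply: gram_unit.
  by rewrite /row_free mxrank_tr.
pose G := invmx (B *m B^T); pose H := invmx (C^T *m C).
have GT : G^T = G by rewrite /G trmx_inv trmx_mul trmxK.
have HT : H^T = H by rewrite /H trmx_inv trmx_mul trmxK.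
pose X := B^T *m G *m H *m C^T.
have AX : A *m X = C *m H *m C^T.
  by rewrite AE /X !mulmxA -(mulmxA C B) -(mulmxA C) mulmxV // mulmx1.
have XA : X *m A = B^T *m G *m B.
  by rewrite AE /X !mulmxA -(mulmxA _ C^T C) -(mulmxA _ H) mulVmx // mulmx1.
exists X; split.
- rewrite AX [in LHS]AE !mulmxA -(mulmxA _ C^T C) -(mulmxA C H).
  by rewrite mulVmx // mulmx1 -AE.
- rewrite XA /X !mulmxA -(mulmxA _ B B^T) -(mulmxA _ (B *m B^T)).
  by rewrite mulmxV // mulmx1.
- by rewrite AX !trmx_mul trmxK HT mulmxA.
- by rewrite XA !trmx_mul trmxK GT mulmxA.
Qed.

Lemma mpinvP (R : realType) (m n : nat) (A : 'M[R]_(m, n)) :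
  penrose A (mpinv A).
Proof. by apply: xgetPex; exact: penrose_exists. Qed.

Lemma penrose_unique (R : realType) (m n : nat) (A : 'M[R]_(m, n))
    (X Y : 'M[R]_(n, m)) :
  penrose A X -> penrose A Y -> X = Y.
Proof.
move=> [X1 X2 X3 X4] [Y1 Y2 Y3 Y4].
have AXY : A *m X = A *m Y.
  rewrite -[LHS]X3 -[in LHS]Y1 -!mulmxA mulmxA trmx_mul X3 Y3 mulmxA.
  by rewrite X1.
have XAY : X *m A = Y *m A.
  rewrite -[LHS]X4 -[in LHS]Y1 !mulmxA -mulmxA trmx_mul X4 Y4 -mulmxA.
  by rewrite (mulmxA A) X1.
by rewrite -X2 -mulmxA AXY mulmxA XAY Y2.
Qed.

(* Main.v *)
(** Since [A] and [A^T] have the same range they have the same kernel, which is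
    the orthogonal complement of the range, and [A] is injective on its range.
    Write [r0 = s + p] with [s] in the range and [p] in the kernel; [p != 0]
    because [b] is not in the range.  A linear relation among [r0, ..., A^l r0]
    has no constant term, as [p != 0]; cancelling powers of [A] in what remains
    gives [s = A u] for some [u] in [K_(l-1)(A, r0)].  Hence the GMRES residual
    is [r = p].  As the Krylov space lies in [range A + <p>], subtracting the
    component along [r] puts [xt - x0] in [range A = range A^T], which
    characterizes [xt] among the least squares solutions. *)
Require Import Defs.
From mathcomp Require Import all_boot all_order all_algebra.
From mathcomp Require Import boolp classical_sets reals.

Set Implicit Arguments.
Unset Strict Implicit.
Unset Printing Implicit Defensive.

Import Order.TTheory GRing.Theory Num.Theory.

Local Open Scope ring_scope.

(** * The Euclidean inner product *)

Section Dot.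
Variables (R : realType) (n : nat).
Implicit Types (u v w : 'cV[R]_n) (A : 'M[R]_n).

Lemma dotC u v : dot u v = dot v u.
Proof. by rewrite /dot -[u^T *m v]trmxK trmx_mul trmxK mxE. Qed.

Lemma dotDr u v w : dot u (v + w) = dot u v + dot u w.
Proof. by rewrite /dot mulmxDr mxE. Qed.

Lemma dotNr u v : dot u (- v) = - dot u v.
Proof. by rewrite /dot mulmxN mxE. Qed.

Lemma dotZr a u v : dot u (a *: v) = a * dot u v.
Proof. by rewrite /dot -scalemxAr mxE. Qed.

Lemma dot_mulmxr A u v : dot u (A *m v) = dot (A^T *m u) v.
Proof. by rewrite /dot trmx_mul trmxK mulmxA. Qed.

Lemma dot0l u : dot 0 u = 0.
Proof. by rewrite /dot trmx0 mul0mx mxE. Qed.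

Lemma dot_sqr u : dot u u = \sum_(i < n) u i 0 ^+ 2.
Proof. by rewrite /dot mxE; apply: eq_bigr => i _; rewrite mxE expr2. Qed.

Lemma dot_ge0 u : 0 <= dot u u.
Proof. by rewrite dot_sqr sumr_ge0 // => i _; rewrite sqr_ge0. Qed.

Lemma dot_eq0 u : (dot u u == 0) = (u == 0).
Proof.
apply/idP/eqP => [|->]; last by rewrite dot0l.
rewrite dot_sqr psumr_eq0 => [/allP u0|i _]; last exact: sqr_ge0.
apply/colP => i; rewrite [RHS]mxE; apply/eqP.
by rewrite -sqrf_eq0; apply: u0; rewrite mem_index_enum.
Qed.

Lemma ler_enorm u v : (enorm u <= enorm v) = (dot u u <= dot v v).
Proof. by rewrite /enorm -!dot_sqr ler_sqrt ?dot_ge0. Qed.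

End Dot.

(** * Linear relations among Krylov vectors *)

Section Krylov.
Variables (R : realType) (n : nat).
Implicit Types (v : 'cV[R]_n) (A : 'M[R]_n).

Lemma exprS_mulmx A k v : A ^+ k.+1 *m v = A *m (A ^+ k *m v).
Proof. by rewrite exprS mulmxA. Qed.

Lemma mulmx_sum_pow A v (c : nat -> R) m :
  A *m (\sum_(i < m) c i *: (A ^+ i *m v))
  = \sum_(i < m) c i *: (A ^+ i.+1 *m v).
Proof.
rewrite mulmx_sumr; apply: eq_bigr => i _.
by rewrite -scalemxAr exprS_mulmx.
Qed.

Lemma sum_pow_krylov A v (c : nat -> R) k :
  \sum_(i < k) c i *: (A ^+ i *m v) \in krylov A v k.
Proof.
apply: memv_suml => i _; apply/memvZ/memv_span/mapP.
by exists (i : nat); rewrite // mem_iota ltn_ord.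
Qed.

(** The [k] generators cannot be free. Coefficients are indexed by [nat] rather than by ['I_k] so
    that they can be shifted later. *)
Lemma krylov_dependent A v k : (\dim (krylov A v k) < k)%N ->
  exists c : nat -> R, \sum_(i < k) c i *: (A ^+ i *m v) = 0 /\
    exists2 i, (i < k)%N & c i != 0.
Proof.
set X := [seq A ^+ i *m v | i <- iota 0 k] => dimX.
have sX : size X == k by rewrite size_map size_iota.
have nfX : ~~ free (Tuple sX) by rewrite /free (eqP sX) neq_ltn dimX.
have XE (i : 'I_k) : X`_i = A ^+ i *m v.
  by rewrite (nth_map 0%N) ?size_iota // nth_iota.
have [f [f0 [i fi]]] : exists f : 'I_k -> R,
    \sum_i f i *: X`_i = 0 /\ exists i, f i != 0.
  apply: contrapT => noF; case/negP: nfX; apply/freeP => f f0 i.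
  apply/eqP/negPn/negP => fi; apply: noF.
  by exists f; split=> //; exists i.
exists (fun j => if insub j is Some j' then f j' else 0); split.
  by rewrite -[RHS]f0; apply: eq_bigr => j _; rewrite valK XE.
by exists i; rewrite // valK.
Qed.

(** Injectivity of [A] on its range strips the outer [A]. If [c 0] is nonzero, the relation is
    solved for [v]; otherwise a power of [A] is factored out and the induction continues with
    shifted coefficients. *)
Lemma cancel_pow_relation A v m (c : nat -> R) :
  (forall y : 'cV_n, A *m (A *m y) = 0 -> A *m y = 0) -> v \in mxrange A ->
  A *m (\sum_(i < m) c i *: (A ^+ i *m v)) = 0 ->
  (exists2 i, (i < m)%N & c i != 0) ->
  exists d : nat -> R, v = \sum_(i < m.-1) d i *: (A ^+ i.+1 *m v).
Proof.
move=> Ainj vA; elim: m c => [|m IH] c; first by move=> _ [].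
move=> Arel [i lti ci].
have : \sum_(j < m.+1) c j *: (A ^+ j *m v) = 0.
  have [w wE] : exists w, \sum_(j < m.+1) c j *: (A ^+ j *m v) = A *m w.
    apply/mxrangeP/memv_suml => -[[|j] ltj] _; apply: memvZ => /=.
      by rewrite expr0 mul1mx.
    by apply/mxrangeP; exists (A ^+ j *m v); rewrite exprS_mulmx.
  by rewrite wE Ainj // -wE.
rewrite big_ord_recl expr0 mul1mx.
under eq_bigr do rewrite lift0.
rewrite -(mulmx_sum_pow _ _ (fun j => c j.+1)).
have [c0|c0] := eqVneq (c 0%N) 0.
  rewrite c0 scale0r add0r => Arel'.
  case: i lti ci => [|i] lti ci; first by rewrite c0 eqxx in ci.
  have [d dE] := IH (fun j => c j.+1) Arel' (ex_intro2 _ _ i lti ci).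
  (* For positive [m], the induction hypothesis gives a sum one term too short, which is padded with
     a zero. *)
  exists (fun j => if (j < m.-1)%N then d j else 0) => /=.
  case: m {IH Arel Arel' lti} dE => [|m] //= dE; first by rewrite {1}dE !big_ord0.
  rewrite big_ord_recr /= ltnn scale0r addr0 {1}dE.
  by apply: eq_bigr => j _; rewrite ltn_ord.
move/eqP; rewrite addr_eq0 => /eqP vE.
exists (fun j => - (c 0%N)^-1 * c j.+1) => /=.
under eq_bigr do rewrite -scalerA.
rewrite -scaler_sumr -(mulmx_sum_pow _ _ (fun j => c j.+1)).
by rewrite scaleNr -scalerN -vE scalerA mulVf ?scale1r.
Qed.

End Krylov.

(** * Matrices with the same range as their transpose *)

Section EqualRanges.
Variables (R : realType) (n : nat) (A : 'M[R]_n).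
Hypothesis hA : mxrange A = mxrange A^T.

(** The squared norm of [A y] pairs [y] with [A^T A y], a vector of range [A], hence orthogonal to
    the kernel of [A^T]. *)
Lemma mxrange_tr_ker (y : 'cV_n) : A^T *m y = 0 -> A *m y = 0.
Proof.
move=> Ay; apply/eqP; rewrite -dot_eq0 dot_mulmxr.
have /mxrangeP[z ->] : A^T *m (A *m y) \in mxrange A.
  by rewrite hA; apply/mxrangeP; exists (A *m y).
by rewrite dotC dot_mulmxr Ay dot0l.
Qed.

Lemma mxrange_tr_inj (y : 'cV_n) : A *m (A *m y) = 0 -> A *m y = 0.
Proof.
move=> AAy; apply/eqP; rewrite -dot_eq0.
have /mxrangeP[z zE] : A *m y \in mxrange A^T.
  by rewrite -hA; apply/mxrangeP; exists y.
by rewrite {2}zE dot_mulmxr trmxK AAy dot0l.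
Qed.

(** From [l + 1] terms, one is lost as the constant term vanishes and another in solving for [s];
    this leaves [l - 1] powers for [u]. *)
Lemma krylov_residual_split (s p : 'cV[R]_n) l :
  s \in mxrange A -> A^T *m p = 0 -> p != 0 ->
  (\dim (krylov A (s + p) l.+1) <= l)%N ->
  exists2 u, u \in krylov A (s + p) l.-1 & A *m u = s.
Proof.
move=> sA Ap p0 dimK.
have powE i : A ^+ i.+1 *m (s + p) = A ^+ i.+1 *m s.
  by rewrite exprSr -!mulmxA mulmxDr (mxrange_tr_ker Ap) addr0.
have [c [rel [i lti ci]]] := krylov_dependent (k := l.+1) dimK.
have relA : c 0%N *: (s + p) + A *m \sum_(j < l) c j.+1 *: (A ^+ j *m s) = 0.
  rewrite -[RHS]rel big_ord_recl expr0 mul1mx; congr (_ + _).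
  rewrite (mulmx_sum_pow _ _ (fun j => c j.+1)).
  by apply: eq_bigr => j _; rewrite lift0 powE.
(* Pairing with [p] kills the range of [A] and leaves [c 0] times the squared norm of [p]. *)
have c0 : c 0%N = 0.
  have := congr1 (dot p) relA.
  have [z sE] := mxrangeP _ _ sA.
  rewrite dotDr dotZr dotDr {1}sE !dot_mulmxr Ap !dot0l add0r addr0.
  rewrite [RHS]dotC dot0l => /eqP; rewrite mulf_eq0 dot_eq0 (negPf p0) orbF.
  by move/eqP.
rewrite c0 scale0r add0r in relA.
case: i lti ci => [|i] lti ci; first by rewrite c0 eqxx in ci.
have [d dE] := cancel_pow_relation (c := fun j => c j.+1) mxrange_tr_inj sA relA
  (ex_intro2 _ _ i lti ci).
exists (\sum_(j < l.-1) d j *: (A ^+ j *m (s + p))).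
  exact: sum_pow_krylov.
by rewrite (mulmx_sum_pow _ _ d) [RHS]dE; apply: eq_bigr => j _; rewrite powE.
Qed.

End EqualRanges.

(** * The Moore-Penrose inverse and least squares *)

Lemma mpinv_range (R : realType) (n : nat) (A : 'M[R]_n) (y : 'cV[R]_n) :
  y \in mxrange A^T -> mpinv A *m (A *m y) = y.
Proof.
case/mxrangeP=> z ->; have [AXA _ _ sXA] := mpinvP A.
by rewrite !mulmxA -sXA -trmx_mul mulmxA AXA.
Qed.

Lemma mpinv_ker (R : realType) (n : nat) (A : 'M[R]_n) (y : 'cV[R]_n) :
  A^T *m y = 0 -> mpinv A *m y = 0.
Proof.
move=> Ay; have [_ XAX sAX _] := mpinvP A.
by rewrite -XAX -(mulmxA (mpinv A)) -sAX trmx_mul -!mulmxA Ay !mulmx0.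
Qed.

Lemma mpinv_residual (R : realType) (n : nat) (A : 'M[R]_n) (y : 'cV[R]_n) :
  A^T *m (y - A *m (mpinv A *m y)) = 0.
Proof.
have [AXA _ sAX _] := mpinvP A.
by rewrite mulmxBr (mulmxA A) -sAX (mulmxA A^T) -trmx_mul AXA subrr.
Qed.

(** Least squares solutions differ by elements of the kernel of [A], which is orthogonal to the
    range of [A^T]. For the formula, [mpinv A] kills the residual and [mpinv A *m A] fixes
    [xt - x0]. *)
Lemma lsq_projection (R : realType) (n : nat) (A : 'M[R]_n)
    (b x0 xt : 'cV[R]_n) :
  A^T *m (b - A *m xt) = 0 -> xt - x0 \in mxrange A^T ->
  orthogonal_projection (lsq_solutions A b) x0 xt /\
  xt = mpinv A *m b + (1%:M - mpinv A *m A) *m x0.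
Proof.
move=> Ar xtA; split.
  have lsq : A^T *m A *m xt = A^T *m b.
    by move/eqP: Ar; rewrite mulmxBr subr_eq0 mulmxA => /eqP.
  split=> // z zE.
  have Azt : A *m (z - xt) = 0.
    apply/eqP; rewrite -dot_eq0 dot_mulmxr.
    by rewrite mulmxA mulmxBr zE lsq subrr dot0l.
  have [w wE] := mxrangeP _ _ xtA.
  by rewrite dotC -[x0 - xt]opprB dotNr wE dot_mulmxr trmxK Azt dot0l oppr0.
have := mpinv_ker Ar; rewrite mulmxBr => /eqP; rewrite subr_eq0 => /eqP ->.
by rewrite mulmxBl mul1mx addrCA -mulmxA -!mulmxBr mpinv_range // addrC subrK.
Qed.

Theorem theorem3 (R : realType) (n : nat) (A : 'M[R]_n) (b x0 : 'cV[R]_n)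
    (l : nat) (x : 'cV[R]_n)
    (hl : max_krylov_dim A (b - A *m x0) l)
    (hA : mxrange A = mxrange A^T)
    (hb : b \notin mxrange A)
    (hx : gmres_iterate A b x0 l.-1 x) :
  let r := b - A *m x in
  let xt := x - (dot r (x - x0) / dot r r) *: r in
  orthogonal_projection (lsq_solutions A b) x0 xt /\
  xt = mpinv A *m b + (1%:M - mpinv A *m A) *m x0.
Proof.
move=> r xt; case: hl hx => _ /(_ l.+1).
set r0 := b - A *m x0 => dimK [/= xK xmin].
pose s := A *m (mpinv A *m r0); pose p := r0 - s.
have r0E : r0 = s + p by rewrite addrC subrK.
have sA : s \in mxrange A by apply/mxrangeP; exists (mpinv A *m r0).
have Ap : A^T *m p = 0 by exact: mpinv_residual.
have p0 : p != 0.
  apply: contraNneq hb => pE; apply/mxrangeP; exists (mpinv A *m r0 + x0).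
  by rewrite mulmxDr -[A *m (_ *m _)]addr0 -pE -r0E subrK.
have [u uK Au] : exists2 u, u \in krylov A r0 l.-1 & A *m u = s.
  by rewrite r0E; apply: krylov_residual_split => //; rewrite -r0E.
have orth y : dot p (A *m y) = 0 by rewrite dot_mulmxr Ap dot0l.
have rE : r = p.
  (* By Pythagoras [r = p + e] is at least as long as [p], with equality only for [e = 0]; the
     competitor [u + x0] has residual exactly [p]. *)
  pose e := A *m (mpinv A *m r0 - (x - x0)).
  have rpe : r = p + e.
    by rewrite /e /r /p /s !mulmxBr addrA subrK opprB addrA subrK.
  suff : e == 0 by rewrite rpe => /eqP ->; rewrite addr0.
  rewrite -dot_eq0 eq_le dot_ge0 andbT.
  have := xmin (u + x0); rewrite -/r addrK => /(_ uK).
  have -> : b - A *m (u + x0) = p.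
    by rewrite mulmxDr Au /p /r0 opprD addrCA addrC.
  rewrite ler_enorm rpe dotDr ![dot (p + e) _]dotC.
  rewrite [dot p (p + e)]dotDr [dot e (p + e)]dotDr.
  by rewrite [dot e p]dotC [dot p e]orth addr0 add0r gerDl.
apply: lsq_projection.
  have -> : A *m xt = A *m x.
    by rewrite mulmxBr -scalemxAr rE (mxrange_tr_ker hA Ap) scaler0 subr0.
  by rewrite -/r rE.
have [q [a qaE]] : exists q a, x - x0 = A *m q + a *: p.
  have : x - x0 \in (mxrange A + <[p]>)%VS.
    apply: subvP xK; apply/span_subvP => _ /mapP[[|i] _ ->].
      by rewrite expr0 mul1mx -/r0 r0E memv_add ?memv_line.
    apply: (subvP (addvSl _ _)); apply/mxrangeP; exists (A ^+ i *m r0).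
    by rewrite exprS_mulmx.
  by case/memv_addP=> _ /mxrangeP[q ->] [_ /vlineP[a ->] ->]; exists q, a.
rewrite -hA; apply/mxrangeP; exists q.
(* As [p] is orthogonal to [A q], the lifting coefficient equals [a], and the two multiples of [p]
   cancel. *)
rewrite /xt addrAC rE qaE dotDr dotZr orth add0r mulfK ?dot_eq0 //.
exact: addrK.
Qed.
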